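(* Let $X$ be a convex cone of a linear space, and let $Y$ be a Banach space equipped with the ordering $\leq_K$ generated by a sharp closed convex cone $K\subseteq Y$. Let $f:X\to Y$ be sublinear, i.e., assume that for all $x,y\in X$ and $t,s>0$, $$f(tx+sy)\leq_{K}tf(x)+sf(y).$$ Assume that $p\in X$ possesses the following two properties: (i) for all $t>0$, $f(tp)=tf(p)$; (ii) for all $x\in X$, there exist $y\in X$ and $t>0$ such that $x+y=tp$. Then there exists an additive and positively homogeneous function $g:X\to Y$ such that $g(x)\leq_K f(x)$ for all $x\in X$ and $g(p)=f(p)$.
   Context: Spaces are real. A cone is a nonempty set $K$ with $tK\subseteq K$ for all $t>0$; a convex cone is thus closed under addition and multiplication by positive scalars. The dual cone of $K\subseteq Y$ is $K^{\circ}:=\{\varphi\in Y^{*}\mid\varphi(y)\geq 0\text{ for all }y\in K\}$, where $Y^*$ is the topological dual; $K$ is sharp if $K^{\circ}$ has nonempty interior in $Y^*$ (norm topology). The order is $x\leq_K y$ iff $y-x\in K$. Positively homogeneous: $g(tx)=tg(x)$ for all $t>0$, $x\in X$. *)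

(* Defs.v *)
From HB Require Import structures.
From mathcomp Require Import all_boot all_order all_algebra.
From mathcomp Require Import all_classical all_reals all_analysis.
From mathcomp Require Import ring lra.

Set Implicit Arguments.
Unset Strict Implicit.
Unset Printing Implicit Defensive.

Import Order.TTheory GRing.Theory Num.Theory.
Import numFieldNormedType.Exports.

Local Open Scope classical_set_scope.
Local Open Scope ring_scope.

Section Cones.
Context {R : realType} {V : lmodType R}.

Definition is_cone (K : set V) : Prop :=
  K !=set0 /\ forall (t : R) (x : V), 0 < t -> K x -> K (t *: x).

Definition convex_cone (K : set V) : Prop := is_cone K /\ convex_set K.

Lemma convex_coneP (K : set V) :
  convex_cone K <-> is_cone K /\ forall x y, K x -> K y -> K (x + y).
Proof.
split=> -[[K0 KZ] Kc]; split=> //.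
- move=> x y Kx Ky.
  have h0 : 0 <= (2^-1 : R) by rewrite invr_ge0.
  have h1 : (2^-1 : R) <= 1 by rewrite invf_le1 ?ler1n.
  have := Kc x y (Itv01 h0 h1); rewrite !inE => /(_ Kx Ky) /(KZ 2 _ (ltr0Sn _ _)).
  suff -> : 2 *: (2^-1 *: x + (1 - 2^-1) *: y) = x + y by [].
  rewrite scalerDr !scalerA mulfV ?pnatr_eq0// scale1r.
  by rewrite (_ : 2 * (1 - 2^-1) = 1) ?scale1r//; lra.
- apply/convex_setW => x y; rewrite !inE => Kx Ky k k0 k1.
  by rewrite inE; apply: Kc; apply: KZ; rewrite // subr_gt0.
Qed.

Definition cone_le (K : set V) (x y : V) : Prop := K (y - x).

End Cones.

Notation "x <=_[ K ] y" := (cone_le K x y)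
  (at level 70, K at level 200, y at next level,
   format "x  <=_[ K ]  y") : ring_scope.

(* The topological dual of Y: continuous linear functionals, normed by the
   operator norm; interiors of sets of functionals refer to this norm. *)
Section DualSpace.
Context {R : realType} (Y : normedModType R).

Definition dual_pred : {pred (Y -> R)} :=
  [pred f : Y -> R | `[< scalar f /\ continuous f >]].

Record dual := Dual { dual_fun :> Y -> R ; _ : dual_fun \in dual_pred }.

HB.instance Definition _ := [isSub for dual_fun].
HB.instance Definition _ := [Choice of dual by <:].

Lemma dual_submod_closed : submod_closed dual_pred.
Proof.
split=> [|a f g].
  apply/asboolP; split=> [b x y|x]; last exact: cvg_cst.
  by rewrite /= mulr0 addr0.
move=> /asboolP[fl fc] /asboolP[gl gc]; apply/asboolP; split=> [b x y|x].
  by rewrite /= !fctE fl gl/= /GRing.scale/=; ring.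
by apply: cvgD; [apply: cvgM; [exact: cvg_cst|exact: fc]|exact: gc].
Qed.

HB.instance Definition _ :=
  GRing.isSubmodClosed.Build _ _ dual_pred dual_submod_closed.
HB.instance Definition _ := [SubChoice_isSubLmodule of dual by <:].

Lemma dual_scalar (f : dual) : scalar f.
Proof. by case: f => f /= /asboolP[]. Qed.

Lemma dual_continuous (f : dual) : continuous f.
Proof. by case: f => f /= /asboolP[]. Qed.

Definition dual_norm (f : dual) : R :=
  sup [set `|f x| | x in [set x : Y | `|x| <= 1]].

Lemma dual0 (f : dual) : f 0 = 0.
Proof. by have := dual_scalar f (-1) 0 0; rewrite scaler0 addr0 mulN1r addNr. Qed.

Lemma dualZ (f : dual) (a : R) (x : Y) : f (a *: x) = a * f x.
Proof. by have := dual_scalar f a x 0; rewrite dual0 !addr0. Qed.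

Lemma dual_has_sup (f : dual) :
  has_sup [set `|f x| | x in [set x : Y | `|x| <= 1]].
Proof.
split; first by exists `|f 0|, 0 => //=; rewrite normr0.
have /cvgrPdist_lt /(_ 1 ltr01) /nbhs_norm0P [e /= e0 fe] :=
  @dual_continuous f 0.
exists (2 / e) => _ [x /= x1 <-].
have := fe ((e / 2) *: x).
rewrite /= dual0 sub0r normrN dualZ normrM.
rewrite normrZ ger0_norm ?divr_ge0 ?(ltW e0)// => H.
have /H : e / 2 * `|x| < e by nra.
move=> H1; have e20 : 0 < e / 2 by rewrite divr_gt0.
by apply/ltW; rewrite -invf_div -[ltRHS]mulr1 ltr_pdivlMl.
Qed.

Lemma dual_norm_ub (f : dual) (x : Y) : `|f x| <= dual_norm f * `|x|.
Proof.
have [->|x0] := eqVneq x 0; first by rewrite dual0 !normr0 mulr0.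
have nx : 0 < `|x| by rewrite normr_gt0.
rewrite -ler_pdivrMr// mulrC.
apply: sup_upper_bound; first exact: dual_has_sup.
exists (`|x|^-1 *: x) => /=; last by rewrite dualZ normrM normfV normr_id.
by rewrite normrZ normfV normr_id mulVf ?gt_eqF.
Qed.

Lemma dual_norm_lub (f : dual) (M : R) :
  (forall x, `|x| <= 1 -> `|f x| <= M) -> dual_norm f <= M.
Proof.
move=> fM; apply: ge_sup; first by have [] := dual_has_sup f.
by move=> _ [x /= x1 <-]; exact: fM.
Qed.

Lemma dual_norm_ge0 (f : dual) : 0 <= dual_norm f.
Proof.
apply: (le_trans (normr_ge0 (f 0))); apply: sup_upper_bound.
  exact: dual_has_sup.
by exists 0 => //=; rewrite normr0.
Qed.

Lemma dual_norm_ub1 (f : dual) (x : Y) : `|x| <= 1 -> `|f x| <= dual_norm f.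
Proof.
move=> x1; apply: le_trans (dual_norm_ub f x) _.
by rewrite ler_piMr// dual_norm_ge0.
Qed.

Lemma dual_ler_normD (f g : dual) :
  dual_norm (f + g) <= dual_norm f + dual_norm g.
Proof.
apply: dual_norm_lub => x x1.
by apply: le_trans (ler_normD _ _) _; apply: lerD; exact: dual_norm_ub1.
Qed.

Lemma dual_normrZ (a : R) (f : dual) : dual_norm (a *: f) = `|a| * dual_norm f.
Proof.
have le (b : R) (g : dual) : dual_norm (b *: g) <= `|b| * dual_norm g.
  apply: dual_norm_lub => x x1.
  by rewrite [leLHS]normrM ler_wpM2l// dual_norm_ub1.
apply/eqP; rewrite eq_le le /=.
have [->|a0] := eqVneq a 0; first by rewrite normr0 mul0r dual_norm_ge0.
rewrite -ler_pdivlMl ?normr_gt0// -normfV.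
by have := le a^-1 (a *: f); rewrite scalerA mulVf// scale1r.
Qed.

Lemma dual_norm0_eq0 (f : dual) : dual_norm f = 0 -> f = 0.
Proof.
move=> f0; apply/val_inj/funext => x; apply/eqP; rewrite -normr_le0.
by have := dual_norm_ub f x; rewrite f0 mul0r.
Qed.

HB.instance Definition _ := Lmodule_isNormed.Build R dual
  dual_ler_normD dual_normrZ dual_norm0_eq0.

Definition dual_cone (K : set Y) : set dual :=
  [set phi | forall y, K y -> 0 <= phi y].

Definition sharp (K : set Y) : Prop := (dual_cone K)° !=set0.

End DualSpace.

(* A map defined on a cone X of V is represented by a total function on V whose
   values outside X are never used. *)
Section FunctionsOnCones.
Context {R : realType} {V W : lmodType R}.

Definition sublinear (X : set V) (K : set W) (f : V -> W) : Prop :=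
  forall (x y : V) (t s : R), X x -> X y -> 0 < t -> 0 < s ->
    f (t *: x + s *: y) <=_[K] t *: f x + s *: f y.

Definition additive_on (X : set V) (g : V -> W) : Prop :=
  forall x y : V, X x -> X y -> g (x + y) = g x + g y.

Definition pos_homogeneous_on (X : set V) (g : V -> W) : Prop :=
  forall (t : R) (x : V), 0 < t -> X x -> g (t *: x) = t *: g x.

End FunctionsOnCones.

(* Main.v *)
(* Since K is sharp, some phi in the interior of the dual cone satisfies
   c |y| <= phi y on K, by norming functionals; hence order intervals are
   controlled in norm and every downward directed set bounded below has an
   infimum. Zorn's lemma then gives a minimal sublinear h <= f with h p = f p.
   Comparing h with x |-> inf_t (h (x + t a) - t h a) shows
   h (x + a) = h x + h a as soon as that infimum is finite and equals h p at p.
   This holds for a = p, and the resulting additivity of h along p makes it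
   hold for every a. The same argument with values in R yields the norming
   functionals. *)
Require Import Defs.
From mathcomp Require Import all_boot all_order all_algebra.
From mathcomp Require Import all_classical all_reals all_analysis.
From mathcomp Require Import lra.

Set Implicit Arguments.
Unset Strict Implicit.
Unset Printing Implicit Defensive.

Import Order.TTheory GRing.Theory Num.Theory.
Import numFieldNormedType.Exports.

Local Open Scope classical_set_scope.
Local Open Scope ring_scope.

(** * Orders generated by cones *)

Definition lower_bound_of {R : realType} {W : lmodType R} (K A : set W) (m : W) :=
  forall u, A u -> m <=_[K] u.

Definition is_glb {R : realType} {W : lmodType R} (K A : set W) (l : W) :=
  lower_bound_of K A l /\ forall m, lower_bound_of K A m -> m <=_[K] l.

Definition down_directed {R : realType} {W : lmodType R} (K A : set W) :=
  forall u v, A u -> A v -> exists w, [/\ A w, w <=_[K] u & w <=_[K] v].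

(** Isolates the only completeness that the argument needs, so that it applies both to [R] and to
    [Y]. *)
Definition directed_complete {R : realType} {W : lmodType R} (K : set W) :=
  forall A, A !=set0 -> down_directed K A -> (exists m, lower_bound_of K A m) ->
    exists l, is_glb K A l.

Section OrderedSpace.
Context {R : realType} {W : lmodType R} (K : set W).
Hypothesis K0 : K 0.
Hypothesis KD : forall x y, K x -> K y -> K (x + y).
Hypothesis KZ : forall (t : R) x, 0 < t -> K x -> K (t *: x).
Hypothesis Kpointed : forall x, K x -> K (- x) -> x = 0.
Hypothesis Kcomplete : directed_complete K.

Lemma cone_le_refl x : x <=_[K] x.
Proof. by rewrite /cone_le subrr. Qed.

Lemma cone_le_trans y x z : x <=_[K] y -> y <=_[K] z -> x <=_[K] z.
Proof. by move=> xy yz; have := KD yz xy; rewrite addrA subrK. Qed.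

Lemma cone_le_anti x y : x <=_[K] y -> y <=_[K] x -> x = y.
Proof.
move=> xy yx; apply/eqP; rewrite -subr_eq0; apply/eqP/Kpointed => //.
by rewrite opprB.
Qed.

Lemma cone_leD x y x' y' :
  x <=_[K] y -> x' <=_[K] y' -> x + x' <=_[K] y + y'.
Proof. by move=> xy xy'; have := KD xy xy'; rewrite addrACA -opprD. Qed.

Lemma cone_leDl z x y : x <=_[K] y -> z + x <=_[K] z + y.
Proof. by apply: cone_leD; exact: cone_le_refl. Qed.

Lemma cone_leDr z x y : x <=_[K] y -> x + z <=_[K] y + z.
Proof. by move=> xy; apply: cone_leD => //; exact: cone_le_refl. Qed.

Lemma cone_leZ (t : R) x y : 0 < t -> x <=_[K] y -> t *: x <=_[K] t *: y.
Proof. by move=> t0 /(KZ t0); rewrite scalerBr. Qed.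

Lemma cone_le_subl x y z : x - z <=_[K] y <-> x <=_[K] y + z.
Proof. by rewrite /cone_le opprB addrA. Qed.

Lemma cone_le_subr x y z : x <=_[K] y - z <-> x + z <=_[K] y.
Proof. by rewrite /cone_le opprD addrA addrAC. Qed.

Lemma cone_leZl (t : R) x y : 0 < t -> t^-1 *: x <=_[K] y <-> x <=_[K] t *: y.
Proof.
move=> t0; have tN0 : t != 0 by rewrite gt_eqF.
split=> [/(cone_leZ t0)|/(@cone_leZ t^-1)].
  by rewrite scalerA divff ?scale1r.
by rewrite scalerA mulVf ?scale1r ?invr_gt0//; apply.
Qed.

(** The map [u |-> z + t *: u] is an order isomorphism, so the bound can be solved for [u]. This
    allows passing to infima one variable at a time. *)
Lemma glb_affine (A : set W) a (t : R) m z :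
  is_glb K A a -> 0 < t -> (forall u, A u -> m <=_[K] z + t *: u) ->
  m <=_[K] z + t *: a.
Proof.
move=> [_ glbA] t0 mle; rewrite addrC.
apply/cone_le_subl/cone_leZl => //; apply: glbA => u Au.
by apply/cone_leZl/cone_le_subl => //; rewrite addrC; exact: mle.
Qed.

(** * Sublinear maps and their pointwise infima *)

Section SublinearMaps.
Context {V : lmodType R} (X : set V).
Hypothesis XD : forall x y, X x -> X y -> X (x + y).
Hypothesis XZ : forall (t : R) x, 0 < t -> X x -> X (t *: x).

(** Splitting [t] as [t / 2 + t / 2] gives one inequality; applying it to the factor [t^-1] at
    [t *: x] gives the other. *)
Lemma sublinearZ (h : V -> W) (t : R) x :
  sublinear X K h -> 0 < t -> X x -> h (t *: x) = t *: h x.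
Proof.
move=> hsub t0 Xx.
have hZle (s : R) y : 0 < s -> X y -> h (s *: y) <=_[K] s *: h y.
  move=> s0 Xy; have s20 : 0 < s / 2 by rewrite divr_gt0.
  by have := hsub _ _ _ _ Xy Xy s20 s20; rewrite -(scalerDl y) -(scalerDl (h y)) -splitr.
apply: cone_le_anti; first exact: hZle.
have tV0 : 0 < t^-1 by rewrite invr_gt0.
have := hZle _ _ tV0 (XZ t0 Xx).
rewrite scalerA mulVf ?gt_eqF// scale1r => /(cone_leZ t0).
by rewrite scalerA divff ?gt_eqF// scale1r.
Qed.

Lemma sublinearD (h : V -> W) x y :
  sublinear X K h -> X x -> X y -> h (x + y) <=_[K] h x + h y.
Proof.
move=> hsub Xx Xy.
by have := hsub _ _ _ _ Xx Xy ltr01 ltr01; rewrite !scale1r.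
Qed.

(** The last assumption is sublinearity at the level of the sets [A x]; it survives taking infima in
    [u] and [v] successively. It serves both for chains in Zorn's lemma and for the comparison
    map. *)
Lemma sublinear_inf (A : V -> set W) :
  (forall x, X x -> A x !=set0) ->
  (forall x, X x -> down_directed K (A x)) ->
  (forall x, X x -> exists m, lower_bound_of K (A x) m) ->
  (forall x y (t s : R) u v, X x -> X y -> 0 < t -> 0 < s -> A x u -> A y v ->
    exists2 w, A (t *: x + s *: y) w & w <=_[K] t *: u + s *: v) ->
  exists l, sublinear X K l /\ forall x, X x -> is_glb K (A x) (l x).
Proof.
move=> A0 Adir Alb Acomb.
have /choice[l lP] x : exists l, X x -> is_glb K (A x) l.
  have [Xx|nXx] := pselect (X x); last by exists 0.
  by have [l ?] := Kcomplete (A0 x Xx) (Adir x Xx) (Alb x Xx); exists l.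
exists l; split=> // x y t s Xx Xy t0 s0.
apply: (glb_affine (lP y Xy)) => // v Av; rewrite [t *: l x + _]addrC.
apply: (glb_affine (lP x Xx)) => // u Au; rewrite [s *: v + _]addrC.
have [w Aw wle] := Acomb _ _ _ _ _ _ Xx Xy t0 s0 Au Av.
apply: cone_le_trans wle; apply: (lP _ _).1 => //.
by apply: XD; exact: XZ.
Qed.

(** * Minimal sublinear maps and their additivity *)

Section MinimalSublinear.
Context (f : V -> W) (p : V).
Hypothesis fsub : sublinear X K f.
Hypothesis Xp : X p.
Hypothesis Xdom : forall x, X x ->
  exists y (t : R), [/\ X y, 0 < t & x + y = t *: p].

Let admissible (h : V -> W) :=
  [/\ sublinear X K h, forall x, X x -> h x <=_[K] f x & h p = f p].

Let minimal (h : V -> W) := forall h', admissible h' ->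
  (forall x, X x -> h' x <=_[K] h x) -> forall x, X x -> h x <=_[K] h' x.

Lemma minimal_sublinear_exists : exists2 h, admissible h & minimal h.
Proof.
have fadm : admissible f by split=> // x _; exact: cone_le_refl.
pose T := {h : V -> W | admissible h}.
(* The order is reversed because Zorn's lemma yields maximal elements. It is only a preorder, since
   values outside [X] are ignored. *)
pose ge (h h' : T) := `[< forall x, X x -> sval h' x <=_[K] sval h x >].
have [||C Ctot|[h hadm] hmin] := @ZL_preorder T (exist _ f fadm) ge.
- by move=> h; apply/asboolP => x _; exact: cone_le_refl.
- move=> h1 h2 h3 /asboolP h12 /asboolP h23; apply/asboolP => x Xx.
  by apply: cone_le_trans (h12 x Xx); exact: h23.
- have [[h0 Ch0]|C0] := pselect (exists h, C h); last first.
    by exists (exist _ f fadm) => h Ch; case: C0; exists h.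
  pose A x := [set sval h x | h in C].
  have [x Xx|x Xx|x Xx|x y t s u v Xx Xy t0 s0|l [lsub lglb]] := @sublinear_inf A.
  + by exists (sval h0 x), h0.
  + move=> _ _ [h1 Ch1 <-] [h2 Ch2 <-].
    have [/asboolP h12|/asboolP h21] := Ctot _ _ Ch1 Ch2.
      by exists (sval h2 x); split; [exists h2|exact: h12|exact: cone_le_refl].
    by exists (sval h1 x); split; [exists h1|exact: cone_le_refl|exact: h21].
  (* From [t *: f p = h (x + y)], which is below [h x + f y], comes a lower bound for [h x]
     independent of [h]. *)
  + have [y [t [Xy t0 xyE]]] := Xdom Xx.
    exists (t *: f p - f y) => _ [[h [hsub hf hp]] _ <-] /=.
    apply/cone_le_subl; rewrite -hp -(sublinearZ hsub)// -xyE.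
    apply: cone_le_trans (cone_leDl (h x) (hf _ Xy)).
    exact: sublinearD.
  + move=> [h1 Ch1 <-] [h2 Ch2 <-].
    have [/asboolP h12|/asboolP h21] := Ctot _ _ Ch1 Ch2.
      exists (sval h2 (t *: x + s *: y)); first by exists h2.
      have [h2sub _ _] := svalP h2.
      apply: cone_le_trans (h2sub _ _ _ _ Xx Xy t0 s0) _.
      by apply: cone_leDr; apply: cone_leZ => //; exact: h12.
    exists (sval h1 (t *: x + s *: y)); first by exists h1.
    have [h1sub _ _] := svalP h1.
    apply: cone_le_trans (h1sub _ _ _ _ Xx Xy t0 s0) _.
    by apply: cone_leDl; apply: cone_leZ => //; exact: h21.
  + have lle h x : C h -> X x -> l x <=_[K] sval h x.
      by move=> Ch Xx; apply: (lglb x Xx).1; exists h.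
    have ladm : admissible l.
      split=> // [x Xx|].
        have [_ hf _] := svalP h0.
        by apply: cone_le_trans (hf x Xx); exact: lle.
      have [_ _ h0p] := svalP h0.
      apply: cone_le_anti; first by rewrite -h0p; exact: lle.
      apply: (lglb p Xp).2 => _ [h _ <-]; have [_ _ ->] := svalP h.
      exact: cone_le_refl.
    by exists (exist _ l ladm) => h Ch; apply/asboolP => x; exact: lle.
- exists h => // h' h'adm h'h.
  by have /asboolP := hmin (exist _ h' h'adm) (asboolT h'h).
Qed.

(* Minimality is tested against [x |-> inf_t (h (x + t a) - t h a)]; the
   assumption on [a] keeps that infimum finite and equal to [h p] at [p]. *)
Lemma minimal_additive_at (h : V -> W) (a : V) :
  admissible h -> minimal h -> X a ->
  (forall t s : R, 0 < t -> 0 < s -> h (t *: a + s *: p) = t *: h a + s *: h p) ->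
  forall x, X x -> h (x + a) = h x + h a.
Proof.
move=> [hsub hf hp] hmin Xa hap.
have hD x y : X x -> X y -> h (x + y) <=_[K] h x + h y by exact: sublinearD.
have hZ (t : R) x : 0 < t -> X x -> h (t *: x) = t *: h x by exact: sublinearZ.
pose A x := [set h (x + t *: a) - t *: h a | t in [set t : R | 0 < t]].
(* Writing [s = t + r], subadditivity bounds the increment of [h] by [r *: h a]; monotonicity in the
   parameter makes [A x] directed. *)
have Adecr x (t s : R) : X x -> 0 < t -> t <= s ->
    h (x + s *: a) - s *: h a <=_[K] h (x + t *: a) - t *: h a.
  move=> Xx t0; rewrite le_eqVlt => /predU1P[<-|ts]; first exact: cone_le_refl.
  have [r r0 ->] : exists2 r, 0 < r & s = t + r.
    by exists (s - t); rewrite ?subr_gt0// addrC subrK.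
  apply/cone_le_subl; rewrite !scalerDl !addrA subrK -hZ//.
  by apply: hD; [apply: XD => //; exact: XZ|exact: XZ].
have [x Xx|x Xx|x Xx|x y t s u v Xx Xy t0 s0|l [lsub lglb]] := @sublinear_inf A.
- by exists (h (x + 1 *: a) - 1 *: h a), 1 => /=.
- move=> _ _ [t t0 <-] [s s0 <-].
  have [ts|/ltW st] := leP t s.
    exists (h (x + s *: a) - s *: h a).
    by split; [exists s|exact: Adecr|exact: cone_le_refl].
  exists (h (x + t *: a) - t *: h a).
  by split; [exists t|exact: cone_le_refl|exact: Adecr].
(* By [hap], [t *: h a + s *: h p] is the value of [h] at [(x + t *: a) + y], so subadditivity gives
   a bound free of [t]. *)
- have [y [s [Xy s0 xyE]]] := Xdom Xx.
  exists (s *: h p - h y) => _ [t /= t0 <-].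
  apply/cone_le_subl; rewrite addrAC; apply/cone_le_subr.
  rewrite [s *: _ + _]addrC -hap// -xyE addrA [t *: a + x]addrC.
  by apply: hD => //; apply: XD => //; exact: XZ.
- move=> [r /= r0 <-] [q /= q0 <-].
  (* The parameter [t * r + s * q] makes the multiples of [h a] cancel, leaving sublinearity of [h]
     at [x + r *: a] and [y + q *: a]. *)
  exists (h (t *: x + s *: y + (t * r + s * q) *: a) - (t * r + s * q) *: h a).
    by exists (t * r + s * q) => //=; rewrite addr_gt0 ?mulr_gt0.
  apply/cone_le_subl; rewrite !scalerBr !scalerA !scalerDl.
  rewrite [Z in cone_le _ _ Z]addrACA !subrK [X in h X]addrACA.
  rewrite -!scalerA -!scalerDr.
  by apply: hsub => //; apply: XD => //; exact: XZ.
- have lle x : X x -> l x <=_[K] h (x + a) - h a.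
    move=> Xx; apply: (lglb x Xx).1; exists 1 => //=.
    by rewrite !scale1r.
  have lh x : X x -> l x <=_[K] h x.
    move=> Xx; apply: cone_le_trans (lle x Xx) _.
    by apply/cone_le_subl; exact: hD.
  have ladm : admissible l.
    split=> // [x Xx|].
      by apply: cone_le_trans (hf x Xx); exact: lh.
    rewrite -hp; apply: cone_le_anti; first exact: lh.
    apply: (lglb p Xp).2 => _ [t /= t0 <-].
    have := hap t 1 t0 ltr01; rewrite !scale1r addrC => ->.
    by rewrite addrAC subrr add0r; exact: cone_le_refl.
  move=> x Xx; apply: cone_le_anti; first exact: hD.
  apply/cone_le_subr; apply: cone_le_trans (lle x Xx).
  exact: hmin.
Qed.

Theorem additive_minorant : exists g : V -> W,
  [/\ additive_on X g, pos_homogeneous_on X g,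
      (forall x, X x -> g x <=_[K] f x) & g p = f p].
Proof.
have [h hadm hmin] := minimal_sublinear_exists.
have [hsub hf hp] := hadm.
have hZ (t : R) x : 0 < t -> X x -> h (t *: x) = t *: h x by exact: sublinearZ.
have hDp x : X x -> h (x + p) = h x + h p.
  apply: (minimal_additive_at hadm hmin Xp) => t s t0 s0.
  by rewrite -!scalerDl hZ ?addr_gt0.
exists h; split=> // x a Xx Xa.
apply: (minimal_additive_at hadm hmin Xa) => // t s t0 s0.
(* Factoring [t *: a + s *: p] as [s *: ((s^-1 * t) *: a + p)] reduces the requirement on [a] to
   additivity along [p]. *)
have ts0 : 0 < s^-1 * t by rewrite mulr_gt0 ?invr_gt0.
have tE : t = s * (s^-1 * t) by rewrite mulVKf ?gt_eqF.
rewrite {1}tE -scalerA -scalerDr hZ//; last by apply: XD => //; exact: XZ.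
rewrite hDp; last exact: XZ.
by rewrite hZ// scalerDr scalerA -tE.
Qed.

End MinimalSublinear.
End SublinearMaps.
End OrderedSpace.

(** * The scalar case and norming functionals *)

Lemma directed_complete_nneg (R : realType) :
  directed_complete [set x : R^o | 0 <= x].
Proof.
move=> A A0 _ [m mA].
have infA : has_inf A.
  by split=> //; exists m => u /mA; rewrite /cone_le /= subr_ge0.
exists (inf A); split=> [u Au|m' m'A].
  by rewrite /cone_le /= subr_ge0; apply: ge_inf => //; case: infA.
rewrite /cone_le /= subr_ge0; apply: lb_le_inf => // u /m'A.
by rewrite /cone_le /= subr_ge0.
Qed.

Section NormingFunctional.
Context {R : realType} {Y : normedModType R}.

(* Hahn-Banach: [additive_minorant] for the norm, with values in [R]. *)
Lemma norming_functional (y : Y) :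
  exists phi : dual Y, `|phi| <= 1 /\ phi y = `|y|.
Proof.
have [g [gD gZ gle gy]] : exists g : Y -> R^o,
    [/\ additive_on setT g, pos_homogeneous_on setT g,
        (forall x, setT x -> g x <=_[[set a : R^o | 0 <= a]] `|x|)
      & g y = `|y|].
  apply: (@additive_minorant R R^o [set a | 0 <= a] _ _ _ _ _ Y setT _ _
    (fun x => `|x| : R^o)) => //.
  - by rewrite /= lexx.
  - by move=> a b /= a0 b0; exact: addr_ge0.
  - by move=> t a /= t0 a0; rewrite mulr_ge0// ltW.
  - by move=> a /= a0; rewrite oppr_ge0 => a0'; apply/le_anti; rewrite a0 a0'.
  - exact: directed_complete_nneg.
  - move=> x z t s _ _ t0 s0; rewrite /cone_le /= subr_ge0.
    by rewrite (le_trans (ler_normD _ _))// !normrZ !gtr0_norm.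
  (* Here [y] plays the role of [p], and the cone is the whole space. *)
  - by move=> x _; exists (y - x), 1; split => //; rewrite scale1r addrC subrK.
have g0 : g 0 = 0.
  by apply: (addrI (g 0)); rewrite -gD// !addr0.
have gN x : g (- x) = - g x.
  by apply/eqP; rewrite -addr_eq0 -gD// addNr g0.
have gscal : scalar g.
  move=> a x z; rewrite gD//; congr (_ + _).
  have [a0|a0|->] := ltgtP a 0; [|exact: gZ|by rewrite scale0r g0 mul0r].
  rewrite -[LHS]opprK -gN -scaleNr gZ ?oppr_gt0//.
  by rewrite scaleNr opprK.
have gnorm x : `|g x| <= `|x|.
  have gx z : g z <= `|z| by have := gle z I; rewrite /cone_le /= subr_ge0.
  by rewrite ler_norml gx lerNl -gN -(normrN x) gx.
have gcont : continuous g.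
  move=> x; apply/cvgrPdist_lt => e e0; near=> z.
  rewrite -gN -gD//; apply: (le_lt_trans (gnorm _)).
  by near: z; exact: cvgr_dist_lt.
have gP : g \in @dual_pred R Y by apply/asboolP.
exists (Dual gP); split=> //.
by apply: dual_norm_lub => x; apply: le_trans; exact: gnorm.
Unshelve. all: by end_near. Qed.

End NormingFunctional.

(** * Sharp cones and uniformly positive functionals *)

Section SharpCone.
Context {R : realType} {Y : normedModType R} (K : set Y).

(** Equivalently, the slice of [K] where [phi] equals 1 is bounded by [c^-1]: a bounded base of the
    cone. *)
Definition well_based_by (phi : dual Y) (c : R) :=
  0 < c /\ forall y, K y -> c * `|y| <= phi y.

(** If the ball of radius [e] around [phi] lies in the dual cone, so does [phi - (e / 2) *: psi]
    with [psi] norming [y]; evaluating it at [y] gives the bound with [c = e / 2]. *)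
Lemma sharp_well_based : sharp K -> exists phi c, well_based_by phi c.
Proof.
move=> [phi /nbhs_ballP [e /= e0 ephi]].
exists phi, (e / 2); split=> [|y Ky]; first by rewrite divr_gt0.
have [psi [psi1 psiy]] := norming_functional y.
have : dual_cone K (phi - (e / 2) *: psi).
  apply: ephi; rewrite -ball_normE /= opprB addrC subrK.
  rewrite normrZ gtr0_norm ?divr_gt0//.
  by rewrite (le_lt_trans (ler_piMr _ psi1))//; lra.
by move=> /(_ y Ky) phipsi; rewrite -subr_ge0 -psiy.
Qed.

Lemma well_based_pointed phi c : well_based_by phi c ->
  forall y, K y -> K (- y) -> y = 0.
Proof.
move=> [c0 phiK] y Ky KNy; apply/eqP; rewrite -normr_le0 -(pmulr_rle0 _ c0).
have := phiK _ Ky; have := phiK _ KNy.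
by rewrite normrN -scaleN1r dualZ mulN1r; lra.
Qed.

End SharpCone.

(** * Order completeness from norm completeness *)

Section ClosedWellBasedCone.
Context {R : realType} {Y : completeNormedModType R} (K : set Y).
Hypothesis K0 : K 0.
Hypothesis KD : forall x y, K x -> K y -> K (x + y).
Hypothesis Kcl : closed K.

(* On a well-based cone the norm of an order increment is controlled by the
   increment of [phi], so the net of tails of [A] is Cauchy. *)
Lemma well_based_directed_complete phi c :
  well_based_by K phi c -> directed_complete K.
Proof.
move=> [c0 phiK] A [a Aa] Adir [m mA].
have phiB x y : phi (x - y) = phi x - phi y.
  by rewrite -[x - y]addrC -scaleN1r dual_scalar mulN1r addrC.
have phi_mono x y : x <=_[K] y -> phi x <= phi y.
  by move=> /phiK; rewrite phiB; have := normr_ge0 (y - x); nra.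
pose F := filter_from A (fun u => [set w | A w /\ w <=_[K] u]).
have FF : ProperFilter F.
  apply: filter_from_proper; last first.
    by move=> u Au; exists u; split=> //; exact: cone_le_refl.
  apply: filter_from_filter; first by exists a.
  move=> u v Au Av; have [w [Aw wu wv]] := Adir _ _ Au Av.
  by exists w => // z [Az zw]; split; split=> //; exact: cone_le_trans zw _.
have infA : has_inf (phi @` A).
  split; first by exists (phi a), a.
  by exists (phi m) => _ [u Au <-]; exact/phi_mono/mA.
have Fcauchy : cauchy F.
  apply/cauchy_exP => e e0.
  (* With [phi u] within [c * e] of the infimum, every [w] of the tail below [u] satisfies
     [c * |u - w| <= phi u - phi w < c * e]. *)
  have [_ [u Au <-] phiu] := inf_adherent (mulr_gt0 c0 e0) infA.
  exists u, u => // w [Aw wu]; rewrite -ball_normE /=.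
  have infw : inf (phi @` A) <= phi w by apply: ge_inf; [case: infA|exists w].
  by have := phiK _ wu; rewrite phiB; nra.
have Fl : F --> lim F by exact: cauchy_cvg.
(* Both properties of the infimum hold along the tails and pass to the limit because [K] is
   closed. *)
exists (lim F); split=> [u Au|m' m'A].
  apply: (@closed_cvg _ _ F _ id (fun w => K (u - w))).
  - by apply: closed_comp Kcl => w _; apply: cvgB; [exact: cvg_cst|exact: cvg_id].
  - by exists u => // w [].
  - exact: Fl.
apply: (@closed_cvg _ _ F _ id (fun w => K (w - m'))).
- by apply: closed_comp Kcl => w _; apply: cvgB; [exact: cvg_id|exact: cvg_cst].
- by exists a => // w [Aw _]; exact: m'A.
- exact: Fl.
Qed.

End ClosedWellBasedCone.

(** The origin is the limit of [t *: y] as [t] decreases to 0, for any [y] in [K]. *)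
Lemma closed_cone0 (R : realType) (Y : normedModType R) (K : set Y) :
  is_cone K -> closed K -> K 0.
Proof.
move=> [[y Ky] KZ] Kcl.
apply: (@closed_cvg _ _ (0^'+ : set_system R) _ (fun t : R => t *: y) K Kcl).
  near=> t; apply: KZ => //; near: t; exact: nbhs_right_gt.
rewrite -(scale0r y); apply: cvgZl.
by apply: cvg_at_right_filter; exact: cvg_id.
Unshelve. all: by end_near. Qed.

Theorem corollary4p6 (R : realType) (V : lmodType R) (X : set V)
    (Y : completeNormedModType R) (K : set Y) (f : V -> Y) (p : V) :
  convex_cone X ->
  convex_cone K -> closed K -> sharp K ->
  sublinear X K f ->
  X p ->
  (forall t : R, 0 < t -> f (t *: p) = t *: f p) ->
  (forall x, X x -> exists y (t : R), [/\ X y, 0 < t & x + y = t *: p]) ->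
  exists g : V -> Y,
    [/\ additive_on X g,
        pos_homogeneous_on X g,
        (forall x, X x -> g x <=_[K] f x)
      & g p = f p].
Proof.
move=> /convex_coneP[[_ XZ] XD] /convex_coneP[Kcone KD] Kcl Ksharp fsub Xp _ Xdom.
have K0 := closed_cone0 Kcone Kcl.
have [phi [c Kphi]] := sharp_well_based Ksharp.
apply: (additive_minorant (K := K)) => //.
- by case: Kcone.
- exact: well_based_pointed Kphi.
- exact: well_based_directed_complete Kphi.
Qed.
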